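(* Let $J=[0,\infty)$, let $f:J\to\mathbb{R}$ be a function that is differentiable on $J^{\circ}=(0,\infty)$, and let $a,b\in J$ with $0<a<b$ and $f'\in L[a,b]$. If $|f'|$ is convex on $J^{\circ}$, then $$\left|\frac{1}{b-a}\int_{a}^{b}f(x)\,dx+\frac{a f(b)-b f(a)}{2(b-a)}-\frac12 f\left(\frac{a+b}{2}\right)\right|\le\left(\frac{5}{48}a+\frac{7}{48}b\right)|f'(a)|+\left(\frac{7}{48}a+\frac{5}{48}b\right)|f'(b)| .$$
   Context: $L[a,b]$ denotes the space of (Lebesgue) integrable functions on $[a,b]$. *)

(* Defs.v *)
From mathcomp Require Export all_boot all_order all_algebra.
From mathcomp Require Export all_classical all_reals all_analysis.

(* Main.v *)
(* With F a primitive of f, the function F x + (p - x) * f x has derivative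
   (p - x) * f' x.  Taking p = a + b / 2 on [a, (a + b) / 2] and p = b + a / 2
   on [(a + b) / 2, b], its increments add up to b - a times the quantity to be
   bounded, and p - x >= a / 2 is positive there.  Since |f'| lies below its
   chord on [a, b], the increments are dominated by those of the cubics with
   derivative p - x times the chord, via the mean value theorem; f' is never
   integrated. *)
From mathcomp Require Import ring lra.
Require Import Defs.
Import Order.TTheory GRing.Theory Num.Theory numFieldNormedType.Exports.
Local Open Scope ring_scope.
Local Open Scope classical_set_scope.

(** The functions [k - h] and [k + h] both have nonnegative derivatives, so by the mean value
    theorem neither decreases from [u] to [v]. *)
Lemma ler_dist_is_derive (R : realType) (h k dh dk : R -> R) (u v : R) :
  u <= v ->
  {in `[u, v]%R, forall x : R, is_derive x 1 h (dh x)} ->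
  {in `[u, v]%R, forall x : R, is_derive x 1 k (dk x)} ->
  {in `[u, v]%R, forall x : R, `|dh x| <= dk x} ->
  `|h v - h u| <= k v - k u.
Proof.
move=> uv hD kD dh_le.
have incr (g dg : R -> R) :
    {in `[u, v]%R, forall x : R, is_derive x 1 g (dg x)} ->
    {in `[u, v]%R, forall x, 0 <= dg x} -> 0 <= g v - g u.
  move=> gD dg_ge0; have [||c cuv ->] := @MVT_segment _ g dg u v uv.
  - by move=> x xuv; apply: gD; exact: subset_itv_oo_cc.
  - apply: derivable_within_continuous => x xuv.
    by have [] := gD x xuv.
  - by rewrite mulr_ge0 ?subr_ge0// dg_ge0.
have kBh : 0 <= (k - h) v - (k - h) u.
  apply: (incr _ (fun x => dk x - dh x)) => x xuv.
    by have ? := hD x xuv; have ? := kD x xuv; exact: is_deriveB.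
  by have := dh_le x xuv; rewrite ler_norml subr_ge0 => /andP[].
have kDh : 0 <= (k + h) v - (k + h) u.
  apply: (incr _ (fun x => dk x + dh x)) => x xuv.
    by have ? := hD x xuv; have ? := kD x xuv; exact: is_deriveD.
  by have := dh_le x xuv; rewrite ler_norml; lra.
by move: kBh kDh; rewrite !fctE ler_norml; lra.
Qed.

(** The primitive is the integral of [f] from [l]; the margins [l < a] and [b < u] make its
    derivative two-sided even at [a] and [b]. *)
Lemma continuous_is_derive_Rintegral (R : realType) (f : R -> R) (l u a b : R) :
  l < a -> a <= b -> b < u -> {in `[l, u]%R, continuous f} ->
  exists2 F : R -> R, {in `[a, b]%R, forall x : R, is_derive x 1 F (f x)} &
    \int[@lebesgue_measure R]_(x in `[a, b]) f x = F b - F a.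
Proof.
move=> la ab bu fC.
have fI v : v <= u ->
    (@lebesgue_measure R).-integrable `[l, v] (EFin \o f).
  move=> vu; apply: continuous_compact_integrable; first exact: segment_compact.
  apply: continuous_in_subspaceT => x; rewrite inE/= => xlv.
  by apply: fC; apply: subset_itvl xlv; rewrite bnd_simp.
exists (fun x => \int[@lebesgue_measure R]_(t in `[l, x]) f t).
  move=> x; rewrite in_itv/= => /andP[ax xb].
  have xu := le_lt_trans xb bu; have lx := lt_le_trans la ax.
  have [| FD <-] := continuous_FTC1_closed xu (fI _ (lexx u)) lx.
    by apply: fC; rewrite in_itv/= !ltW.
  by rewrite derive1E; exact/derivableP.
rewrite Rintegral_itvB ?bnd_simp ?(ltW la)//; last exact/fI/ltW.
rewrite Rintegral_itv_obnd_cbnd//.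
apply: integrableS (fI _ (ltW bu)) => //=.
by apply: subset_itv; rewrite bnd_simp// ltW.
Qed.

Lemma convex_function_le_chord (R : realType) (D : set R) (g : R -> R)
    (a b x : R) :
  convex_function D g -> a \in D -> b \in D -> a < b -> a <= x <= b ->
  g x <= ((b - x) * g a + (x - a) * g b) / (b - a).
Proof.
move=> gC aD bD ab /andP[ax xb].
have ba0 : 0 < b - a by rewrite subr_gt0.
(* This is the weight of [a] when [x] is written as a convex combination of [a] and [b]. *)
have t01 : 0 <= (b - x) / (b - a) <= 1.
  by rewrite divr_ge0 ?subr_ge0 ?(ltW ab)//= ler_pdivrMr// mul1r; lra.
have := gC (Itv01 (andP t01).1 (andP t01).2) a b aD bD.
rewrite !convRE/= /unstable.onem; congr (g _ <= _).
  change ((b - x) / (b - a) * a + (1 - (b - x) / (b - a)) * b = x).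
  by field; lra.
by field; lra.
Qed.

(** The cubic [P] is the antiderivative of [(p - x) * (c + d * x)] vanishing at 0. Since [v <= p],
    the weight [p - x] is nonnegative and preserves the bound on [df]. *)
Lemma ler_dist_weighted_affine (R : realType) (F f df : R -> R)
    (p c d u v : R)
    (P := fun x : R => p * c * x + (p * d - c) / 2 * x ^+ 2 - d / 3 * x ^+ 3) :
  u <= v -> v <= p ->
  {in `[u, v]%R, forall x : R, is_derive x 1 F (f x)} ->
  {in `[u, v]%R, forall x : R, is_derive x 1 f (df x)} ->
  {in `[u, v]%R, forall x : R, `|df x| <= c + d * x} ->
  `|(F v + (p - v) * f v) - (F u + (p - u) * f u)| <= P v - P u.
Proof.
move=> uv vp FD fD df_le.
apply: (@ler_dist_is_derive _ (fun x => F x + (p - x) * f x) P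
  (fun x => (p - x) * df x) (fun x => (p - x) * (c + d * x)) _ _ uv) => x xuv.
- have ? := FD x xuv; have ? := fD x xuv.
  by apply: is_derive_eq; rewrite /GRing.scale/=; ring.
- by apply: is_derive_eq; rewrite /GRing.scale/=; field.
have px : 0 <= p - x.
  by move: xuv; rewrite in_itv/= subr_ge0 => /andP[_ /le_trans]; exact.
by rewrite normrM ger0_norm// ler_wpM2l// df_le.
Qed.

(* MathComp-Analysis.  f : [0, +oo[ -> R is a total function of which only the
   values on [0, +oo[ are constrained or used. *)
Theorem theorem5 (R : realType) (f : R -> R) (a b : R)
  (f_diff : {in `]0, +oo[%R, forall x : R, derivable f x 1})
  (a_gt0 : 0 < a) (a_lt_b : a < b)
  (df_integrable :
    (@lebesgue_measure R).-integrable `[a, b] (EFin \o f^`()))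
  (abs_df_convex :
    convex_function (`]0, +oo[%classic : set R) (fun x : R => `|f^`() x|)) :
  `| (b - a)^-1 * (\int[@lebesgue_measure R]_(x in `[a, b]) f x)
     + (a * f b - b * f a) / (2 * (b - a)) - 2^-1 * f ((a + b) / 2) |
  <= (5 / 48 * a + 7 / 48 * b) * `| f^`() a |
   + (7 / 48 * a + 5 / 48 * b) * `| f^`() b |.
Proof.
have ab := ltW a_lt_b.
have gt0D x : x \in `[a, b]%R -> 0 < x.
  by rewrite in_itv/= => /andP[ax _]; exact: lt_le_trans ax.
have fD (x : R) : 0 < x -> is_derive x 1 f (f^`() x).
  by move=> x0; rewrite derive1E; apply/derivableP/f_diff; rewrite in_itv/= x0.
(* The enlarged interval stays inside []0, +oo[], where [f] is differentiable, hence continuous. *)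
have [||||F FD ->] := @continuous_is_derive_Rintegral _ f (a / 2) (b + 1) a b.
- by lra.
- by [].
- by lra.
- move=> x; rewrite in_itv/= => /andP[ax _].
  apply: differentiable_continuous; apply/derivable1_diffP.
  by have [] : is_derive x 1 f (f^`() x) by apply: fD; lra.
pose A := `|f^`() a|; pose B := `|f^`() b|.
(* The chord of [|f'|], in the form intercept plus slope times [x]. *)
have f'_le x : x \in `[a, b]%R ->
    `|f^`() x| <= (b * A - a * B) / (b - a) + (B - A) / (b - a) * x.
  rewrite in_itv/= => axb.
  have -> : (b * A - a * B) / (b - a) + (B - A) / (b - a) * x =
      ((b - x) * A + (x - a) * B) / (b - a) by field; lra.
  have := @convex_function_le_chord _ _ (fun x => `|f^`() x|) a b x
    abs_df_convex.
  by apply=> //; rewrite inE/= in_itv/= andbT// (lt_trans a_gt0).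
pose m := (a + b) / 2.
have am : a <= m by rewrite /m; lra.
have mb : m <= b by rewrite /m; lra.
have subL : {subset `[a, m]%R <= `[a, b]%R}.
  by apply: subset_itvl; rewrite bnd_simp.
have subR : {subset `[m, b]%R <= `[a, b]%R}.
  by apply: subset_itvr; rewrite bnd_simp.
have mp : m <= a + b / 2 by rewrite /m; lra.
have bq : b <= b + a / 2 by lra.
have /= L := @ler_dist_weighted_affine _ _ _ _ _ _ _ _ _ am mp
  (fun x xI => FD x (subL x xI))
  (fun x xI => fD x (gt0D x (subL x xI))) (fun x xI => f'_le x (subL x xI)).
have /= M := @ler_dist_weighted_affine _ _ _ _ _ _ _ _ _ mb bq
  (fun x xI => FD x (subR x xI))
  (fun x xI => fD x (gt0D x (subR x xI))) (fun x xI => f'_le x (subR x xI)).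
have ba0 : 0 < b - a by rewrite subr_gt0.
have /(le_trans (ler_normD _ _)) LM := lerD L M.
rewrite -(ler_pM2l ba0) -[X in X * `|_|](gtr0_norm ba0) -normrM.
(* Both remaining comparisons are equalities: the [F m] terms cancel in the sum of increments, and
   the cubics' increments add up to [b - a] times the right-hand side. *)
rewrite -/A -/B -/m; apply: le_trans (le_trans LM _);
  rewrite le_eqVlt; apply/orP; left; apply/eqP.
  by congr `|_|; rewrite /m; field; lra.
by rewrite /m; field; lra.
Qed.
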